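(* Let $R$ be an associative ring with unity $1$ and let $a,b,c,v,w\in R$ with at least one of $v$, $w$ invertible. If the hybrid $(v,w)$-weighted $(b,c)$-inverse of $a$ exists, then there is $t\in R$ such that $c=cvawbt$ and $bt$ is the hybrid $(v,w)$-weighted $(b,c)$-inverse of $a$.
   Context: For $x\in R$: $xR=\{xr: r\in R\}$ and $rann(x)=\{z\in R: xz=0\}$. An element $y\in R$ is the hybrid $(v,w)$-weighted $(b,c)$-inverse of $a$ if $yvawy=y$, $yvR=bR$ and $rann(c)=rann(wy)$; it is unique if it exists. *)

(* Defs.v *)
From mathcomp Require Import all_boot all_algebra.
From mathcomp Require Import classical_sets.

Set Implicit Arguments.
Unset Strict Implicit.
Unset Printing Implicit Defensive.

Import GRing.Theory.
Local Open Scope ring_scope.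
Local Open Scope classical_set_scope.

(* [pzRingType] does not impose [1 != 0], so the zero ring is allowed. *)

Definition principal_right_ideal (R : pzRingType) (x : R) : set R :=
  [set x * r | r in [set: R]].

Definition rann (R : pzRingType) (x : R) : set R := [set z | x * z = 0].

(* Two-sided invertibility, stated directly since [GRing.unit] would require
   decidability of being a unit. *)
Definition invertible (R : pzRingType) (x : R) : Prop :=
  exists x' : R, x' * x = 1 /\ x * x' = 1.

Definition is_hybrid_inverse (R : pzRingType) (v w b c a y : R) : Prop :=
  [/\ y * v * a * w * y = y,
      principal_right_ideal (y * v) = principal_right_ideal b &
      rann c = rann (w * y)].

(* Main.v *)
(* Since yvR = bR, some s has yv = bs, so y = (yv)awy = b(sawy) is itself of the
   form bt.  Moreover wy(1 - vawy) = 0, and rann(wy) = rann(c) turns this into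
   c(1 - vawy) = 0. *)
Require Import Defs.
From mathcomp Require Import all_boot all_algebra.

Import GRing.Theory.
Local Open Scope ring_scope.

(** No new inverse is built: the given [y] lies in [bR], so [t] only has to factor it as [b * t].
    The identity for [c] is the one [w * y] satisfies, carried over by equality of annihilators. *)

Theorem theorem4p2 (R : pzRingType) (a b c v w : R)
    (hvw : invertible v \/ invertible w)
    (hex : exists y : R, is_hybrid_inverse v w b c a y) :
  exists t : R,
    c = c * v * a * w * b * t /\ is_hybrid_inverse v w b c a (b * t).
Proof.
case: hex => y hy; have [yE idE annE] := hy.
have [s _ bs] : principal_right_ideal b (y * v).
  by rewrite -idE; exists 1; rewrite ?mulr1.
have yt : y = b * (s * a * w * y) by rewrite !mulrA bs yE.
(* Folding [b * t] back to [y] leaves only [c = c * v * a * w * y]. *)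
exists (s * a * w * y); rewrite -(mulrA _ b) -yt; split=> //.
(* [w * y] kills this element because [y * v * a * w * y = y]. *)
have : rann c (1 - v * a * w * y).
  rewrite annE /rann /= mulrBr mulr1 -(mulrA w y) !(mulrA y) yE.
  exact: subrr.
by rewrite /rann /= mulrBr mulr1 !mulrA => /eqP; rewrite subr_eq0 => /eqP.
Qed.
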